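(* Let $b\ge2$, $s\ge1$ and $u\ge0$ be integers and let $\mathbf{e}=(e_1,\dots,e_s)\in\mathbb{N}^s$. Then any $(u,\mathbf{e},s)$-sequence in base $b$ is a $(\lceil u/g\rceil,s)$-sequence in base $b^g$, where $g$ is the least common multiple of $e_1,\dots,e_s$.
   Context: $\mathbb{N}$ denotes the positive integers, $\lambda_s$ Lebesgue measure. An elementary interval in base $b$ is $J=\prod_{i=1}^s[a_ib^{-d_i},(a_i+1)b^{-d_i})$ with integers $d_i\ge0$, $0\le a_i<b^{d_i}$. For integers $0\le u\le m$ and $\mathbf{e}=(e_1,\dots,e_s)\in\mathbb{N}^s$, a set of $b^m$ points in $[0,1)^s$ is a $(u,m,\mathbf{e},s)$-net in base $b$ if every elementary interval $J$ in base $b$ with $\lambda_s(J)\ge b^{u-m}$ and $e_i\mid d_i$ for all $i$ contains exactly $b^m\lambda_s(J)$ of the points. For $\mathbf{x}\in[0,1]^s$, $[\mathbf{x}]_{b,m}$ denotes the coordinatewise $m$-digit truncation of $\mathbf{x}$ in base $b$. For an integer $u\ge0$, a sequence $\mathbf{x}_0,\mathbf{x}_1,\dots$ in $[0,1]^s$ is a $(u,\mathbf{e},s)$-sequence in base $b$ if for all integers $k\ge0$ and $m>u$ the points $[\mathbf{x}_n]_{b,m}$ with $kb^m\le n<(k+1)b^m$ form a $(u,m,\mathbf{e},s)$-net in base $b$. A $(t,s)$-sequence in base $b$ is a $(t,\mathbf{1},s)$-sequence in base $b$ with $\mathbf{1}=(1,\dots,1)$. *)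

(* Defs.v *)
(* MathComp-Analysis *)
From HB Require Import structures.
From mathcomp Require Import all_boot all_order all_algebra.
From mathcomp Require Import all_classical all_reals all_analysis.
Import Order.TTheory GRing.Theory Num.Theory numFieldNormedType.Exports.

Set Implicit Arguments.
Unset Strict Implicit.
Unset Printing Implicit Defensive.

Local Open Scope classical_set_scope.
Local Open Scope ring_scope.

(* s-dimensional Lebesgue measure, by Cavalieri's principle from the
   one-dimensional one. The points of R^s are s-tuples. The value is meaningful
   on Borel sets only, which includes all boxes. *)
Fixpoint lebesgue_tuple (R : realType) (s : nat) :
    set (s.-tuple R) -> \bar R :=
  match s with
  | 0 => fun A => \d_([tuple]) A
  | s'.+1 => fun A =>
      (\int[lebesgue_measure]_(x in [set: R])
         lebesgue_tuple [set t : s'.-tuple R | A (cons_tuple x t)])%E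
  end.

Definition elementary_interval (R : realType) (b s : nat) (d a : 'I_s -> nat) :
    set (s.-tuple R) :=
  [set x | forall i : 'I_s,
     (a i)%:R / b%:R ^+ d i <= tnth x i < (a i + 1)%:R / b%:R ^+ d i].

(* A "set of b^m points" is a multiset: an indexed family in which repeated
   points are counted with multiplicity. *)
Definition is_net (R : realType) (b u m s : nat) (e : 'I_s -> nat)
    (P : 'I_(b ^ m) -> s.-tuple R) : Prop :=
  [/\ (u <= m)%N,
      forall (n : 'I_(b ^ m)) (i : 'I_s), 0 <= tnth (P n) i < 1
    & forall d a : 'I_s -> nat,
        (forall i, (a i < b ^ d i)%N) ->
        let J := @elementary_interval R b s d a in
        ((b%:R ^ (u%:Z - m%:Z))%:E <= lebesgue_tuple J)%E ->
        (forall i, (e i %| d i)%N) ->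
        (#|[pred n | P n \in J]|%:R)%:E = ((b%:R ^+ m)%:E * lebesgue_tuple J)%E].

(* y is a base-b expansion 0.y_0 y_1 y_2 ... of z; the digit y_j has weight
   b^-(j+1). Expansions ending in digits b-1 are allowed, so a b-adic rational
   in (0, 1) has two expansions, and 1 has one. *)
Definition is_expansion (R : realType) (b : nat) (y : nat -> nat) (z : R) :
    Prop :=
  (forall j, (y j < b)%N) /\
  series (fun j => (y j)%:R / b%:R ^+ j.+1 : R) @ \oo --> z.

(* [x]_{b,m}, for x whose i-th coordinate has the expansion y i *)
Definition truncation (R : realType) (b m s : nat) (y : 'I_s -> nat -> nat) :
    s.-tuple R :=
  [tuple \sum_(j < m) (y i j)%:R / b%:R ^+ j.+1 | i < s].

(* Since truncation depends on the chosen expansion, a sequence of points x_n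
   comes with prescribed base-b expansions y n of their coordinates. *)
Definition is_ue_sequence (R : realType) (b u s : nat) (e : 'I_s -> nat)
    (x : nat -> s.-tuple R) (y : nat -> 'I_s -> nat -> nat) : Prop :=
  [/\ forall n i, 0 <= tnth (x n) i <= 1,
      forall n i, is_expansion b (y n i) (tnth (x n) i)
    & forall k m : nat, (u < m)%N ->
        is_net u e (fun j : 'I_(b ^ m) => truncation R b m (y (k * b ^ m + j)%N))].

Definition is_t_sequence (R : realType) (b t s : nat)
    (x : nat -> s.-tuple R) (y : nat -> 'I_s -> nat -> nat) : Prop :=
  is_ue_sequence b t (fun _ : 'I_s => 1%N) x y.

(* The same expansion read in base b^g: each block of g consecutive base-b
   digits, most significant first, is one digit in base b^g. This is a bijection
   between base-b and base-b^g expansions, and the result ends in digits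
   b^g - 1 exactly when y ends in digits b - 1. *)
Definition regroup (b g : nat) (y : nat -> nat) (j : nat) : nat :=
  (\sum_(i < g) y (g * j + i) * b ^ (g - i.+1))%N.

(* Main.v *)
(* Reading base-b digits in blocks of g turns truncation to m digits in base b^g
   into truncation to gm digits in base b, and an elementary interval in base b^g
   with exponents d_i is the elementary interval in base b with exponents g d_i.
   Since e_i | g and u <= g * ceil(u/g), the counting condition in base b^g is an
   instance of the one in base b, for the same set J; its volume is never
   computed. *)
Require Import Defs.
From mathcomp Require Import all_boot all_order all_algebra.
From mathcomp Require Import all_classical all_reals all_analysis.
Import Order.TTheory GRing.Theory Num.Theory.

Set Implicit Arguments.
Unset Strict Implicit.
Unset Printing Implicit Defensive.

Local Open Scope classical_set_scope.
Local Open Scope ring_scope.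

Lemma regroup_lt (b g : nat) (y : nat -> nat) (j : nat) :
  (forall i, (y i < b)%N) -> (regroup b g y j < b ^ g)%N.
Proof.
move=> yb; rewrite /regroup; set z := fun i => y (g * j + i)%N.
have : (forall i, z i < b)%N by move=> i; exact: yb.
rewrite (eq_bigr (fun i : 'I_g => z i * b ^ (g - i.+1))%N) //.
(* The offset [g * j] varies with [g], so the digits are abstracted to [z] before the induction. *)
move: z => z zb {y yb}; elim: g => [|g IHg]; first by rewrite big_ord0.
rewrite big_ord_recr /= subnn expn0 muln1.
rewrite (eq_bigr (fun i : 'I_g => z i * b ^ (g - i.+1) * b)%N); last first.
  by move=> i _; rewrite -mulnA -expnSr subSn.
rewrite -big_distrl /=.
(* Horner step: with v the value of the first g digits, v b + z_g < (v + 1) b, and v + 1 <= b^g by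
   induction. *)
apply: (@leq_trans ((\sum_(i < g) z i * b ^ (g - i.+1)).+1 * b)%N).
  by rewrite mulSn addnC ltn_add2r.
by rewrite expnSr leq_mul2r IHg orbT.
Qed.

Lemma sum_regroup (R : realType) (b g m : nat) (y : nat -> nat) :
  (0 < b)%N ->
  \sum_(j < m) (regroup b g y j)%:R / (b ^ g)%:R ^+ j.+1 =
  \sum_(j < g * m) (y j)%:R / b%:R ^+ j.+1 :> R.
Proof.
move=> b_gt0; have b_neq0 : b%:R != 0 :> R by rewrite pnatr_eq0 -lt0n.
elim: m => [|m IHm]; first by rewrite muln0 !big_ord0.
rewrite big_ord_recr IHm /= mulnSr big_split_ord /=; congr (_ + _).
rewrite /regroup natr_sum mulr_suml; apply: eq_bigr => i _.
rewrite natrM !natrX -exprM -mulrA; congr (_ * _).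
(* The factor b^(g-i-1) cancels, leaving digit i of block m its base-b weight b^-(gm+i+1). *)
have -> : (g * m.+1 = (g - i.+1) + (g * m + i).+1)%N.
  by rewrite -addnS addnCA subnK // mulnSr.
by rewrite exprD invfM mulrA mulfV ?mul1r // expf_neq0.
Qed.

(** The new partial sums are the old ones along the indices g m, a subsequence because g > 0. *)
Lemma is_expansion_regroup (R : realType) (b g : nat) (y : nat -> nat) (z : R) :
  (0 < b)%N -> (0 < g)%N ->
  is_expansion b y z -> is_expansion (b ^ g) (regroup b g y) z.
Proof.
move=> b_gt0 g_gt0 [yb yz]; split=> [j|]; first exact: regroup_lt.
rewrite (_ : series _ =
    series (fun j => (y j)%:R / b%:R ^+ j.+1) \o (fun m => g * m)%N); last first.
  by apply/funext => m; rewrite /series /= !big_mkord sum_regroup.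
apply: cvg_comp yz => A [N _ NA]; exists N => // m /= Nm.
by apply: NA => /=; apply: leq_trans Nm _; rewrite leq_pmull.
Qed.

Lemma truncation_regroup (R : realType) (b g m s : nat)
    (y : 'I_s -> nat -> nat) :
  (0 < b)%N ->
  truncation R (b ^ g) m (fun i => regroup b g (y i)) =
  truncation R b (g * m) y.
Proof.
by move=> b_gt0; apply: eq_from_tnth => i; rewrite !tnth_mktuple sum_regroup.
Qed.

Lemma elementary_interval_expn (R : realType) (b g s : nat) (d a : 'I_s -> nat) :
  @elementary_interval R (b ^ g) s d a =
  elementary_interval b (fun i => g * d i)%N a.
Proof.
by apply/seteqP; split=> x Jx i; move: (Jx i); rewrite natrX -exprM.
Qed.

(** [P] is indexed by [nat] so that one family serves both index types, whose bounds b^(gm) and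
    (b^g)^m are equal but not convertible. *)
Lemma is_net_expn (R : realType) (b g t u m s : nat) (e : 'I_s -> nat)
    (P : nat -> s.-tuple R) :
  (0 < b)%N -> (u <= g * t)%N -> (t <= m)%N -> (forall i, e i %| g)%N ->
  is_net u e (fun n : 'I_(b ^ (g * m)) => P n) ->
  is_net t (fun=> 1%N) (fun n : 'I_((b ^ g) ^ m) => P n).
Proof.
move=> b_gt0 u_le t_le e_dvd [_ P01 Pcount]; split=> // [n i|d a a_lt J J_ge _].
  have n_lt : (n < b ^ (g * m))%N by rewrite expnM.
  exact: (P01 (Ordinal n_lt)).
have /= := Pcount (fun i => g * d i)%N a.
rewrite -elementary_interval_expn -/J natrX -exprM.
have -> : #|[pred n : 'I_(b ^ (g * m)) | P n \in J]| =
          #|[pred n : 'I_((b ^ g) ^ m) | P n \in J]| by rewrite expnM.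
apply=> [i||i]; first by rewrite expnM.
(* (b^g)^(t-m) = b^(gt-gm) >= b^(u-gm), since u <= g t. *)
- apply: le_trans J_ge; rewrite lee_fin natrX exprnP exprz_exp.
  apply: ler_weXz2l; first by rewrite ler1n.
  by rewrite mulrBr -!PoszM lerD2r lez_nat.
- exact: dvdn_mulr.
Qed.

Lemma biglcmn_gt0 (I : finType) (e : I -> nat) :
  (forall i, 0 < e i)%N -> (0 < \big[lcmn/1]_i e i)%N.
Proof.
by move=> e_gt0; elim/big_ind: _ => // m n m0 n0; rewrite lcmn_gt0 m0.
Qed.

Lemma leq_mul_ceil_div (R : realType) (u g : nat) :
  (0 < g)%N -> (u <= g * absz (Num.ceil (u%:R / g%:R : R)))%N.
Proof.
move=> g_gt0; rewrite -(ler_nat R) natrM mulrC -ler_pdivrMr ?ltr0n //.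
(* As u/g > -1, the ceiling is nonnegative and [absz] leaves it unchanged. *)
rewrite natr_absz ger0_norm ?ceil_ge //.
by rewrite ceil_ge0 (lt_le_trans (ltrN10 R)) // divr_ge0.
Qed.

Theorem theorem4 (R : realType) (b s u : nat) (e : 'I_s -> nat)
    (hb : (2 <= b)%N) (hs : (1 <= s)%N) (he : forall i : 'I_s, (0 < e i)%N)
    (x : nat -> s.-tuple R) (y : nat -> 'I_s -> nat -> nat) :
  let g := (\big[lcmn/1]_(i < s) e i)%N in
  is_ue_sequence b u e x y ->
  is_t_sequence (b ^ g)
    (absz (Num.ceil (u%:R / g%:R : R)%R))
    x (fun n i => regroup b g (y n i)).
Proof.
move=> g [x01 xy nets].
have b_gt0 : (0 < b)%N := ltnW hb.
have g_gt0 : (0 < g)%N := biglcmn_gt0 he.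
have u_le := leq_mul_ceil_div R u g_gt0.
split=> // [n i|k m t_lt]; first exact: is_expansion_regroup.
have /nets net : (u < g * m)%N by rewrite (leq_ltn_trans u_le) // ltn_pmul2l.
apply: (is_net_expn
  (P := fun j => truncation R (b ^ g) m
    (fun i => regroup b g (y (k * (b ^ g) ^ m + j)%N i))) b_gt0 u_le (ltnW t_lt)).
  by move=> i; exact: biglcmn_sup.
(* The k-th run of (b^g)^m indices is the k-th run of b^(gm) indices, so the same [k] serves. *)
rewrite -expnM; congr is_net: (net k).
by apply/funext => j; rewrite truncation_regroup.
Qed.
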